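(* Let $R$ be a ring and $a\in R$. Then $a$ has Hirano inverse if and only if $a^2$ has strongly Drazin inverse. In this case, $(a^2)^{sD}=(a^H)^2$ and $a^H=a(a^2)^{sD}$.
   Context: All rings are associative with identity. $N(R)$ denotes the set of all nilpotent elements of $R$. An element $a\in R$ has Hirano inverse if there exists $b\in R$ such that $a^2-ab\in N(R)$, $ab=ba$ and $b=bab$; such a $b$ is unique if it exists and is denoted by $a^H$. An element $x\in R$ has strongly Drazin inverse if there exists $y\in R$ such that $x-xy\in N(R)$, $xy=yx$ and $y=yxy$; such a $y$ is unique if it exists and is denoted by $x^{sD}$. *)

(* Defs.v *)
From mathcomp Require Import all_boot all_algebra.

Set Implicit Arguments.
Unset Strict Implicit.
Unset Printing Implicit Defensive.

Import GRing.Theory.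
Local Open Scope ring_scope.

(* Rings are [pzRingType]: associative, unital, not necessarily commutative,
   and the zero ring is allowed. *)

Definition nilpotent_elt (R : pzRingType) (x : R) : Prop :=
  exists n : nat, x ^+ n = 0.

(* [is_hirano_inverse a b] reads "b = a^H"; the inverse is unique when it
   exists, so the notation a^H is rendered by this relation. *)
Definition is_hirano_inverse (R : pzRingType) (a b : R) : Prop :=
  [/\ nilpotent_elt (a ^+ 2 - a * b), a * b = b * a & b = b * a * b].

Definition has_hirano_inverse (R : pzRingType) (a : R) : Prop :=
  exists b : R, is_hirano_inverse a b.

(* [is_strongly_drazin_inverse x y] reads "y = x^sD", likewise unique. *)
Definition is_strongly_drazin_inverse (R : pzRingType) (x y : R) : Prop :=
  [/\ nilpotent_elt (x - x * y), x * y = y * x & y = y * x * y].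

Definition has_strongly_drazin_inverse (R : pzRingType) (x : R) : Prop :=
  exists y : R, is_strongly_drazin_inverse x y.

(* Main.v *)
Require Import Defs.
From mathcomp Require Import all_boot all_algebra.

Set Implicit Arguments.
Unset Strict Implicit.
Unset Printing Implicit Defensive.

Import GRing.Theory.
Local Open Scope ring_scope.

(** If [b] is the Hirano inverse of [a], then [a ^+ 2 * b ^+ 2 = a * b], so the
    nilpotent element [a ^+ 2 - a * b] is also the one that makes [b ^+ 2] the
    strongly Drazin inverse of [a ^+ 2].

    Conversely, if [y] is the strongly Drazin inverse of [x = a ^+ 2], then
    [b = a * y] works for the same reason, provided that [y] commutes with [a].
    This is the one real point: [y] commutes with everything that commutes
    with [x] ([sdrazin_bicommutant]).  It comes from a Fitting-type
    decomposition along the idempotent [e = x * y]: some power of [x] kills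
    [1 - e] ([sdrazin_expr_annihilates]), whereas [y] is divisible by every
    power of [x] ([outer_inverse_expr]).  Hence [y] kills, on either side,
    whatever a high power of [x] kills.

    The same decomposition gives the uniqueness of the strongly Drazin inverse
    ([sdrazin_unique]), so [(a^2)^sD = (a^H)^2] follows from the forward
    direction, and [a * (a^H)^2 = a^H * a * a^H = a^H]. *)

Section StronglyDrazin.

Variable R : pzRingType.
Implicit Types a b c x y z : R.

(** Multiplying the nilpotent [x - e] by [1 - e], with [e = x * y] idempotent,
    turns it into [x * (1 - e)], and likewise for powers. *)
Lemma sdrazin_expr_annihilates x y :
    is_strongly_drazin_inverse x y ->
  exists n, x ^+ n * (1 - x * y) = 0 /\ (1 - x * y) * x ^+ n = 0.
Proof.
case=> -[n nil_xy] xyC yxy; exists n.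
have ee : x * y * (x * y) = x * y by rewrite -mulrA [y * _]mulrA -yxy.
have eC : GRing.comm x (1 - x * y).
  by apply: commrB (commr1 x) _; rewrite /GRing.comm -mulrA -xyC.
suff xnE : x ^+ n * (1 - x * y) = (x - x * y) ^+ n * (1 - x * y).
  have -> : (1 - x * y) * x ^+ n = x ^+ n * (1 - x * y).
    exact/commrX/commr_sym.
  by rewrite xnE nil_xy mul0r.
elim: n {nil_xy} => [|n IHn]; first by rewrite !expr0.
have xe : (x - x * y) * (1 - x * y) = x * (1 - x * y).
  by rewrite mulrBl [x * y * _]mulrBr mulr1 ee subrr subr0.
by rewrite !exprSr -!mulrA xe eC !mulrA IHn.
Qed.

Lemma outer_inverse_expr x y n :
  x * y = y * x -> y = y * x * y -> y = y ^+ n.+1 * x ^+ n.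
Proof.
move=> xyC yxy; elim: n => [|n IHn]; first by rewrite expr1 mulr1.
by rewrite exprS [x ^+ _]exprSr -mulrA [y ^+ _ * _]mulrA -IHn -xyC mulrA.
Qed.

(** [y] factors through [x ^+ n] on both sides, so it inherits the left and
    right annihilators of every power of [x]. *)
Lemma outer_inverse_annihilator x y c n :
    x * y = y * x -> y = y * x * y ->
  (x ^+ n * c = 0 -> y * c = 0) /\ (c * x ^+ n = 0 -> c * y = 0).
Proof.
move=> xyC yxy; have yE := outer_inverse_expr n xyC yxy.
have xyXC : y ^+ n.+1 * x ^+ n = x ^+ n * y ^+ n.+1.
  by apply: commrX; apply/commr_sym/commrX.
split=> xc0; first by rewrite yE -mulrA xc0 mulr0.
by rewrite yE xyXC mulrA xc0 mul0r.
Qed.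

(** With [e = x * y], the power of [x] that kills [1 - e] commutes past [c],
    so [y * c * (1 - e) = 0 = (1 - e) * c * y]; thus [y * c] and [c * y] both
    equal [y * c * e = e * c * y]. *)
Lemma sdrazin_bicommutant x y c :
  is_strongly_drazin_inverse x y -> x * c = c * x -> y * c = c * y.
Proof.
move=> sdxy xcC; have [n [xne1 e1xn]] := sdrazin_expr_annihilates sdxy.
case: sdxy => _ xyC yxy.
have xncC : x ^+ n * c = c * x ^+ n by apply/commr_sym/commrX/commr_sym.
have [annl _] := outer_inverse_annihilator (c * (1 - x * y)) n xyC yxy.
have [_ annr] := outer_inverse_annihilator ((1 - x * y) * c) n xyC yxy.
have /eqP : y * (c * (1 - x * y)) = 0.
  by apply: annl; rewrite mulrA xncC -mulrA xne1 mulr0.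
rewrite !mulrBr mulr1 subr_eq0 => /eqP ->.
have /eqP : (1 - x * y) * c * y = 0.
  by apply: annr; rewrite -mulrA -xncC mulrA e1xn mul0r.
rewrite !mulrBl mul1r subr_eq0 => /eqP ->.
by rewrite !mulrA -(mulrA y c) -xcC xyC !mulrA.
Qed.

(** Each of the two inverses absorbs the idempotent of the other, so both are
    equal to [y * x * z]. *)
Lemma sdrazin_unique x y z :
    is_strongly_drazin_inverse x y -> is_strongly_drazin_inverse x z ->
  y = z.
Proof.
move=> sdxy sdxz.
have [m [_ exm0]] := sdrazin_expr_annihilates sdxy.
have [n [xn0 _]] := sdrazin_expr_annihilates sdxz.
case: sdxy sdxz => _ xyC yxy [_ xzC zxz].
have [/(_ xn0) yf _] := outer_inverse_annihilator (1 - x * z) n xyC yxy.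
have [_ /(_ exm0) ez] := outer_inverse_annihilator (1 - x * y) m xzC zxz.
move/eqP: yf; rewrite mulrBr mulr1 subr_eq0 => /eqP ->.
by move/eqP: ez; rewrite mulrBl mul1r subr_eq0 xyC mulrA => /eqP <-.
Qed.

Lemma hirano_sdrazin_sqr a b :
  is_hirano_inverse a b -> is_strongly_drazin_inverse (a ^+ 2) (b ^+ 2).
Proof.
case=> nil_ab abC bab.
have a2b2 : a ^+ 2 * b ^+ 2 = a * b.
  by rewrite -(exprMn_comm _ abC) expr2 -mulrA [b * _]mulrA -bab.
have a2b2C : GRing.comm (a ^+ 2) (b ^+ 2).
  by apply: commrX; apply/commr_sym/commrX.
split=> //; first by rewrite a2b2.
by rewrite -mulrA a2b2 expr2 -mulrA [b * (a * b)]mulrA -bab.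
Qed.

Lemma sdrazin_sqr_hirano a y :
  is_strongly_drazin_inverse (a ^+ 2) y -> is_hirano_inverse a (a * y).
Proof.
move=> sday; have yaC : y * a = a * y.
  by apply: sdrazin_bicommutant sday _; rewrite -exprSr exprS.
case: sday => nil_ay _ yay.
split; first by rewrite mulrA.
  by rewrite -[RHS]mulrA yaC.
by rewrite {1}yay expr2 !mulrA -yaC.
Qed.

End StronglyDrazin.

Theorem theorem2p4 (R : pzRingType) (a : R) :
  (has_hirano_inverse a <-> has_strongly_drazin_inverse (a ^+ 2)) /\
  (forall aH a2sD : R,
      is_hirano_inverse a aH ->
      is_strongly_drazin_inverse (a ^+ 2) a2sD ->
      a2sD = aH ^+ 2 /\ aH = a * a2sD).
Proof.
split; first split=> [[b /hirano_sdrazin_sqr]|[y /sdrazin_sqr_hirano]].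
- by exists (b ^+ 2).
- by exists (a * y).
move=> aH a2sD hir sd.
have -> : a2sD = aH ^+ 2 := sdrazin_unique sd (hirano_sdrazin_sqr hir).
by case: hir => _ aHC aHaH; split; rewrite // expr2 mulrA aHC.
Qed.
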